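(* Let $\tau$ be a signature and let $\mathbb{H}$ be a finite $\tau$-structure with universe $H$. Then the following are equivalent: (A1s) $\mathbb{H}$ dismantles to a substructure $\mathbb{I}$ such that $\mathbb{I}^2$ dismantles to its diagonal $\Delta(\mathbb{I}^2)$; (A2s) $\mathbb{H}^2$ dismantles to a substructure of its diagonal $\Delta(\mathbb{H}^2)$; (B1s) $C(\mathbb{G},\mathbb{H})$ is connected for every locally finite $\tau$-structure $\mathbb{G}$; (B2s) there exists some $n\ge 1$ such that $C_n(\mathbb{G},\mathbb{H})$ is connected for every finite $\tau$-structure $\mathbb{G}$; (B3s) $C(\mathbb{L}\times\mathbb{H}^2,\mathbb{H})$ is connected; (B4s) $L(\mathbb{G},\mathbb{H})$ is connected for every finite $\tau$-structure $\mathbb{G}$; (B5s) the projections $\pi_1$ and $\pi_2$ are joined by a walk in $L(\mathbb{H}^2,\mathbb{H})$; (C1s) there exists $g\ge 0$ such that $\mathrm{Hom}(\mathbb{G},\mathbb{H})$ is strongly irreducible with gap $g$ for every $\tau$-structure $\mathbb{G}$; (C2s) there exists $g\ge 0$ such that $\mathrm{Hom}(\mathbb{T}_{\mathbb{H}^2},\mathbb{H})$ is $(\{x\},W)$-mixing for all $x\in T_{\mathbb{H}^2}$ and all $W\subseteq T_{\mathbb{H}^2}$ with $\mathrm{dist}(x,W)\ge g$.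
   Context: A signature $\tau$ is a set of relation symbols, each with an arity $k\ge1$. A $\tau$-structure $\mathbb{H}$ consists of a countable set $H$ (its universe) and, for each $k$-ary $R\in\tau$, a relation $R(\mathbb{H})\subseteq H^k$. Maps are applied to tuples componentwise. A homomorphism $\mathbb{G}\to\mathbb{H}$ is a map $\phi:G\to H$ with $\phi(\mathbf{a})\in R(\mathbb{H})$ for all $R\in\tau$, $\mathbf{a}\in R(\mathbb{G})$; $\mathrm{Hom}(\mathbb{G},\mathbb{H})$ is the set of these. $\mathbb{J}$ is a substructure of $\mathbb{H}$ if $J\subseteq H$ and $R(\mathbb{J})\subseteq R(\mathbb{H})$ for all $R$; it is the substructure induced by $J$ if $R(\mathbb{J})=R(\mathbb{H})\cap J^k$ for every $k$-ary $R$. Domination: $b$ dominates $a$ in $\mathbb{H}$ if for every $k$-ary $R\in\tau$, every $i\in\{1,\dots,k\}$ and every $(a_1,\dots,a_k)\in R(\mathbb{H})$ with $a_i=a$, also $(a_1,\dots,a_{i-1},b,a_{i+1},\dots,a_k)\in R(\mathbb{H})$. A sequence $\mathbb{J}_0,\dots,\mathbb{J}_\ell$ ($\ell\ge0$) is a dismantling sequence if for each $j<\ell$ there are $a_j\ne b_j$ in $J_j$ with $b_j$ dominating $a_j$ in $\mathbb{J}_j$ and $\mathbb{J}_{j+1}$ is the substructure of $\mathbb{J}_j$ induced by $J_j\setminus\{a_j\}$; then $\mathbb{J}_0$ dismantles to $\mathbb{J}_\ell$. The product $\mathbb{H}_1\times\mathbb{H}_2$ has universe $H_1\times H_2$ and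 $R(\mathbb{H}_1\times\mathbb{H}_2)$ consists of all $((a_1,b_1),\dots,(a_k,b_k))$ with $(a_1,\dots,a_k)\in R(\mathbb{H}_1)$, $(b_1,\dots,b_k)\in R(\mathbb{H}_2)$; $\mathbb{H}^2=\mathbb{H}\times\mathbb{H}$, with projections $\pi_1(a,b)=a$, $\pi_2(a,b)=b$ (these are homomorphisms $\mathbb{H}^2\to\mathbb{H}$). The diagonal $\Delta(\mathbb{H}^2)$ is the substructure of $\mathbb{H}^2$ induced by $\{(a,a):a\in H\}$. A walk in a $\tau$-structure $\mathbb{H}$ is a sequence $a_0,i_1,(R_1,\mathbf{a}_1),j_1,a_1,\dots,a_{n-1},i_n,(R_n,\mathbf{a}_n),j_n,a_n$ ($n\ge0$ is its length) with $R_\ell\in\tau$, $\mathbf{a}_\ell\in R_\ell(\mathbb{H})$, $i_\ell\neq j_\ell$, $a_{\ell-1}$ the $i_\ell$-th entry and $a_\ell$ the $j_\ell$-th entry of $\mathbf{a}_\ell$; it joins $a_0$ (starting point) and $a_n$ (ending point). $\mathrm{dist}(a,b)$ is the minimal length of a walk joining $a,b$ ($\infty$ if none); $\mathrm{dist}(V,W)$ is the minimum over $a\in V,b\in W$. An element's degree is the number of tuples (over all relations) in which it occurs; $\mathbb{G}$ is locally finite if all degrees are finite. Forest of walks: $\mathbb{T}_{\mathbb{H}}$ has universe $T_{\mathbb{H}}$ = all walks in $\mathbb{H}$; for $k$-ary $R$, for every $\mathbf{a}=(a_1,\dots,a_k)\in R(\mathbb{H})$, every $i$ and every walk $w$ ending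 at $a_i$, the tuple $(w_1,\dots,w_{i-1},w,w_{i+1},\dots,w_k)$ is in $R(\mathbb{T}_{\mathbb{H}})$, where for $j\neq i$, $w_j$ is $w$ extended by $i,(R,\mathbf{a}),j,a_j$; these are the only tuples. Graphs of homomorphisms (for $\mathbb{H}$ finite): $C_n(\mathbb{G},\mathbb{H})$ has vertex set $\mathrm{Hom}(\mathbb{G},\mathbb{H})$, with $\phi,\psi$ adjacent iff they differ on at most $n$ elements of $G$; $C=C_1$. The $1$-link $\mathbb{L}$ is the $\tau$-structure with universe $\{0,1\}$ and $R(\mathbb{L})=\{0,1\}^k$ for each $k$-ary $R$. $L(\mathbb{G},\mathbb{H})$ has vertex set $\mathrm{Hom}(\mathbb{G},\mathbb{H})$, with $\phi,\psi$ adjacent iff for every $k$-ary $R$ and $(x_1,\dots,x_k)\in R(\mathbb{G})$, $(\gamma_1(x_1),\dots,\gamma_k(x_k))\in R(\mathbb{H})$ for all $\gamma_1,\dots,\gamma_k\in\{\phi,\psi\}$. Such a graph is connected if every two homomorphisms agreeing on all but finitely many elements of $G$ are joined by a walk in the graph. Mixing: $\mathrm{Hom}(\mathbb{G},\mathbb{H})$ is $(V,W)$-mixing ($V,W\subseteq G$) if for all $\phi,\psi\in\mathrm{Hom}(\mathbb{G},\mathbb{H})$ there is $\gamma\in\mathrm{Hom}(\mathbb{G},\mathbb{H})$ agreeing with $\phi$ on $V$ and with $\psi$ on $W$; it is strongly irreducible with gap $g$ if it is $(V,W)$-mixing for all $V,W\subseteq G$ with $\mathrm{dist}(V,W)\ge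 g$ (distance in $\mathbb{G}$). *)

(* Defs.v *)
From mathcomp Require Import all_boot.
From mathcomp Require Import boolp classical_sets cardinality.
From Stdlib Require Import Relation_Operators.

Set Implicit Arguments.
Unset Strict Implicit.
Unset Printing Implicit Defensive.

Local Open Scope classical_set_scope.

Record signature := Signature {
  symbol :> Type;
  arity : symbol -> nat;
  arity_gt0 : forall R, 0 < arity R }.

(* Countability of the universe is not bundled here: the universe of the forest
   of walks is uncountable when the signature is. Where all structures are
   quantified over, [countable [set: G]] is an explicit hypothesis. *)
Record structure (tau : signature) := Structure {
  carrier :> Type;
  interp : forall R : tau, set ((arity R).-tuple carrier) }.

Arguments interp {tau} s R.

Section Structures.
Variable tau : signature.
Implicit Types G H : structure tau.

Record hom G H := Hom {
  hom_fun :> G -> H;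
  hom_interp : forall (R : tau) a, interp G R a -> interp H R (map_tuple hom_fun a) }.

Record substructure H := Substructure {
  suniv : set H;
  srel : forall R : tau, set ((arity R).-tuple H);
  srel_interp : forall (R : tau) (a : (arity R).-tuple H), srel a -> interp H R a;
  srel_univ : forall (R : tau) (a : (arity R).-tuple H),
    srel a -> forall i, suniv (tnth a i) }.

Arguments srel {H} s R.

Definition substructure_le H (J K : substructure H) : Prop :=
  (suniv J `<=` suniv K) /\ (forall R, srel J R `<=` srel K R).

Definition structure_of_sub H (J : substructure H) : structure tau :=
  @Structure tau (set_type (suniv J))
    (fun R => [set a | srel J R (map_tuple val a)]).

Lemma induced_interp H (X : set H) (R : tau) (a : (arity R).-tuple H) :
  (interp H R a /\ forall i, X (tnth a i)) -> interp H R a.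
Proof. by case. Qed.

Lemma induced_univ H (X : set H) (R : tau) (a : (arity R).-tuple H) :
  (interp H R a /\ forall i, X (tnth a i)) -> forall i, X (tnth a i).
Proof. by case. Qed.

Definition induced H (X : set H) : substructure H :=
  @Substructure H X (fun R => [set a | interp H R a /\ forall i, X (tnth a i)])
    (@induced_interp H X) (@induced_univ H X).

Definition is_induced_in H (K : substructure H) (X : set H)
    (J : substructure H) : Prop :=
  suniv J = X /\
  forall R, srel J R = [set a | srel K R a /\ forall i, X (tnth a i)].

Definition full H : substructure H := induced [set: H].

Definition tuple_subst (T : Type) k (a : k.-tuple T) (i : 'I_k) (b : T) :
  k.-tuple T := [tuple if j == i then b else tnth a j | j < k].

Definition dominates H (J : substructure H) (b a : H) : Prop :=
  forall (R : tau) (i : 'I_(arity R)) (t : (arity R).-tuple H),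
    srel J R t -> tnth t i = a -> srel J R (tuple_subst t i b).

(* Every member of a dismantling sequence is a substructure of the first one,
   so the sequence can be taken among the substructures of a fixed H. *)
Definition dismantling_sequence H (l : nat) (J : nat -> substructure H) : Prop :=
  forall j, j < l -> exists a b : H,
    [/\ suniv (J j) a, suniv (J j) b, a <> b, dominates (J j) b a &
        is_induced_in (J j) (suniv (J j) `\ a) (J j.+1)].

Definition dismantles_to H (J K : substructure H) : Prop :=
  exists l (S : nat -> substructure H),
    [/\ dismantling_sequence l S, S 0 = J & S l = K].

Definition product H1 H2 : structure tau :=
  @Structure tau (H1 * H2)%type
    (fun R => [set t | interp H1 R (map_tuple fst t) /\
                       interp H2 R (map_tuple snd t)]).

Definition square H : structure tau := product H H.

Lemma pi1_interp H (R : tau) a :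
  interp (square H) R a -> interp H R (map_tuple fst a).
Proof. by case. Qed.

Lemma pi2_interp H (R : tau) a :
  interp (square H) R a -> interp H R (map_tuple snd a).
Proof. by case. Qed.

Definition pi1 H : hom (square H) H := Hom (@pi1_interp H).
Definition pi2 H : hom (square H) H := Hom (@pi2_interp H).

Definition diagonal_sub H : substructure (square H) :=
  induced [set p : square H | p.1 = p.2].

Definition is_finite G : Prop := finite_set [set: G].

Definition incident_tuples G (x : G) :
    set {R : tau & (arity R).-tuple G} :=
  [set p | interp G (tag p) (tagged p) /\ exists i, tnth (tagged p) i = x].

Definition locally_finite G : Prop :=
  forall x : G, finite_set (incident_tuples x).

(* A step is the portion i, (R, a), j of a walk. The vertices of a walk after
   the starting point are determined by the steps, as the entries a_j. *)
Record step H := Step {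
  step_sym : tau;
  step_tuple : (arity step_sym).-tuple H;
  step_in : 'I_(arity step_sym);
  step_out : 'I_(arity step_sym) }.

Arguments Step {H step_sym}.

Fixpoint is_walk H (a : H) (s : seq (step H)) : Prop :=
  if s is e :: s' then
    [/\ interp H (step_sym e) (step_tuple e), step_in e != step_out e,
        tnth (step_tuple e) (step_in e) = a &
        is_walk (tnth (step_tuple e) (step_out e)) s']
  else True.

Record walk H := Walk {
  walk_start : H;
  walk_steps : seq (step H);
  walkP : is_walk walk_start walk_steps }.

Definition walk_length H (w : walk H) : nat := size (walk_steps w).

Definition walk_end H (w : walk H) : H :=
  last (walk_start w)
    [seq tnth (step_tuple e) (step_out e) | e <- walk_steps w].

(* Minimum of a set of natural numbers in nat + {oo}, where [None] is oo. *)
Definition min_nat (P : set nat) : option nat :=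
  if pselect (exists n, `[< P n >]) is left exP then Some (ex_minn exP)
  else None.

Definition at_least (d : option nat) (g : nat) : Prop :=
  if d is Some n then g <= n else True.

Definition dist H (a b : H) : option nat :=
  min_nat [set n | exists w : walk H,
    [/\ walk_start w = a, walk_end w = b & walk_length w = n]].

Definition dist_set H (V W : set H) : option nat :=
  min_nat [set n | exists a b, [/\ V a, W b & dist a b = Some n]].

Definition is_extension H (w : walk H) (e : step H) (w' : walk H) : Prop :=
  walk_start w' = walk_start w /\ walk_steps w' = rcons (walk_steps w) e.

Definition walk_forest H : structure tau :=
  @Structure tau (walk H)
    (fun R => [set t | exists (a : (arity R).-tuple H) (i : 'I_(arity R)),
       [/\ interp H R a, walk_end (tnth t i) = tnth a i &
           forall j, j != i ->
             is_extension (tnth t i) (Step a i j) (tnth t j)]]).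

Definition one_link : structure tau :=
  @Structure tau bool (fun R => [set: (arity R).-tuple bool]).

Definition C_adj (n : nat) G H (phi psi : hom G H) : Prop :=
  ([set x | phi x <> psi x] #<= `I_n)%card.

Definition L_adj G H (phi psi : hom G H) : Prop :=
  forall (R : tau) (x : (arity R).-tuple G), interp G R x ->
  forall gamma : 'I_(arity R) -> hom G H,
    (forall i, gamma i = phi \/ gamma i = psi) ->
    interp H R [tuple gamma i (tnth x i) | i < arity R].

Definition joined_by_walk (V : Type) (adj : V -> V -> Prop) (u v : V) : Prop :=
  clos_refl_trans V adj u v.

Definition hom_graph_connected G H (adj : hom G H -> hom G H -> Prop) : Prop :=
  forall phi psi : hom G H,
    finite_set [set x | phi x <> psi x] -> joined_by_walk adj phi psi.

Definition mixing G H (V W : set G) : Prop :=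
  forall phi psi : hom G H, exists gamma : hom G H,
    (forall x, V x -> gamma x = phi x) /\ (forall x, W x -> gamma x = psi x).

Definition strongly_irreducible G H (g : nat) : Prop :=
  forall V W : set G, at_least (dist_set V W) g -> mixing H V W.

End Structures.

Arguments C_adj {tau} n {G H} phi psi.
Arguments L_adj {tau G H} phi psi.
Arguments one_link {tau}.
Arguments hom_graph_connected {tau} G H adj.

(* Main.v *)
Require Import Defs.
From mathcomp Require Import all_boot zify.
From mathcomp Require Import boolp classical_sets cardinality.
From Stdlib Require Import Relation_Operators Operators_Properties.

(** If b dominates a, folding a onto b is adjacent to the identity in the graph
    L. Hence a dismantling of H^2 into its diagonal gives an L-walk f_0, ..., f_l
    from pi1 to pi2, and such a walk yields (C1s) and (C2s) through
    gamma(x) = f_(h x) (phi x, psi x), where h x = min(l, dist(x, V)): h varies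
    by at most one on each tuple, so gamma is a homomorphism. Conversely, a
    homomorphism on the product of H^2 with a reflexive path is an L-walk, so
    (C1s) gives an L-walk from pi1 to pi2; products with a large link serve in
    the same way for (B2s) and (B3s).

    For (C2s) => (A1s), dismantle H to a structure I without dominated elements,
    and I^2, keeping its diagonal, to K without dominated elements off the
    diagonal. Mix pi1 at a one-point walk x ending in K with pi2 far away. As all
    extensions of a walk lie in the forest, two inductions from far away towards
    x show that the homomorphism obtained from gamma by retracting I^2 to K
    agrees with the end point map on walks ending in K; at x this puts the end
    point on the diagonal.

    For (A1s) => (B1s), follow a diagonal-preserving L-walk from the identity of
    H^2 into the diagonal near the finite set where phi and psi differ, up to a
    height decreasing with the distance, raising the height one level at a time. *)

Set Implicit Arguments.
Unset Strict Implicit.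
Unset Printing Implicit Defensive.

Local Open Scope classical_set_scope.

(** * Finite sets as sequences, and walks in abstract graphs *)

Lemma finite_set_seq (T : Type) (A : set T) :
  finite_set A -> exists s : seq {classic T}, forall x, A x <-> x \in s.
Proof.
move/(@finite_seqP {classic T}) => [s ->].
by exists s.
Qed.

Section WalksInGraphs.
Variables (V W : Type) (A : V -> V -> Prop) (B : W -> W -> Prop).

Lemma joined_map (F : V -> W) u v :
  (forall u v, A u v -> joined_by_walk B (F u) (F v)) ->
  joined_by_walk A u v -> joined_by_walk B (F u) (F v).
Proof.
move=> AB; elim=> [x y|x|x y z _ IH1 _ IH2]; first exact: AB.
  exact: rt_refl.
exact: rt_trans IH1 IH2.
Qed.

Lemma joined_sym u v : (forall u v, A u v -> A v u) ->
  joined_by_walk A u v -> joined_by_walk A v u.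
Proof.
move=> Asym; elim=> [x y|x|x y z _ IH1 _ IH2].
- by move=> /Asym ?; exact: rt_step.
- exact: rt_refl.
- exact: rt_trans IH2 IH1.
Qed.

(** The sequence is constant from [l] on, so that for a reflexive adjacency consecutive terms are
    adjacent at every index. *)
Lemma joined_seq u v : joined_by_walk A u v -> exists l (f : nat -> V),
  [/\ f 0 = u, forall j, l <= j -> f j = v & forall j, j < l -> A (f j) (f j.+1)].
Proof.
move=> uv; have {}uv := clos_rt_rt1n _ _ _ _ uv.
elim: uv => [x|x y z xy _ [l [f [f0 fl fA]]]].
  by exists 0, (fun=> x).
exists l.+1, (fun j => if j is j'.+1 then f j' else x); split=> //.
- by case=> // j; exact: fl.
- by case=> [|j] ?; [rewrite f0 | exact: fA].
Qed.

Lemma seq_joined (f : nat -> V) l :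
  (forall j, j < l -> A (f j) (f j.+1)) -> joined_by_walk A (f 0) (f l).
Proof.
elim: l => [_|l IH fA]; first exact: rt_refl.
apply: (@rt_trans _ _ _ (f l)); last exact/rt_step/fA.
by apply: IH => j jl; apply: fA; exact: ltnW.
Qed.

End WalksInGraphs.

(** * Homomorphisms and the graphs L and C *)

Section Homomorphisms.
Variable tau : signature.
Implicit Types G H K : structure tau.

Lemma interp_ext H (R : tau) (s t : (arity R).-tuple H) :
  (forall i, tnth s i = tnth t i) -> interp H R s -> interp H R t.
Proof. by move=> /eq_from_tnth ->. Qed.

Lemma hom_ext G H (f g : hom G H) : f =1 g -> f = g.
Proof.
case: f g => f fP [g gP] /funext /= fg; subst g.
by congr Hom; exact: Prop_irrelevance.
Qed.

Lemma hom_interp_tnth G H (f : hom G H) (R : tau) t (y : (arity R).-tuple H) :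
  interp G R t -> (forall i, tnth y i = f (tnth t i)) -> interp H R y.
Proof.
move=> /(hom_interp f) ft yE; apply: interp_ext ft => i.
by rewrite tnth_map yE.
Qed.

Lemma mk_hom G H (f : G -> H) :
  (forall (R : tau) t (y : (arity R).-tuple H), interp G R t ->
     (forall i, tnth y i = f (tnth t i)) -> interp H R y) ->
  exists u : hom G H, u =1 f.
Proof.
move=> fP; suff fh (R : tau) a : interp G R a -> interp H R (map_tuple f a).
  by exists (Hom fh).
by move=> /fP; apply=> i; rewrite tnth_map.
Qed.

Lemma hom_comp_interp G H K (g : hom H K) (f : hom G H) (R : tau) a :
  interp G R a -> interp K R (map_tuple (g \o f) a).
Proof.
move=> /(hom_interp f)/(hom_interp g); apply: interp_ext => i.
by rewrite !tnth_map.
Qed.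

Definition hom_comp G H K (g : hom H K) (f : hom G H) : hom G K :=
  Hom (hom_comp_interp g f).

Lemma hom_id_interp G (R : tau) a :
  interp G R a -> interp G R (map_tuple id a).
Proof. by apply: interp_ext => i; rewrite tnth_map. Qed.

Definition hom_id G : hom G G := Hom (@hom_id_interp G).

Lemma hom_pair_interp G H1 H2 (f : hom G H1) (g : hom G H2) (R : tau) a :
  interp G R a ->
  interp (product H1 H2) R (map_tuple (fun x => (f x, g x)) a).
Proof.
move=> Ga; split.
  by apply: (hom_interp_tnth (f := f) Ga) => i; rewrite !tnth_map.
by apply: (hom_interp_tnth (f := g) Ga) => i; rewrite !tnth_map.
Qed.

Definition hom_pair G H1 H2 (f : hom G H1) (g : hom G H2) :
  hom G (product H1 H2) := Hom (@hom_pair_interp G H1 H2 f g).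

Lemma hom_snd_interp H1 H2 (R : tau) a :
  interp (product H1 H2) R a -> interp H2 R (map_tuple snd a).
Proof. by case. Qed.

Definition hom_snd H1 H2 : hom (product H1 H2) H2 := Hom (@hom_snd_interp H1 H2).

(** The family [gamma] of homomorphisms is traded for the tuple [y] of its values, which turns
    adjacency into an entrywise condition. *)
Lemma L_adjP G H (phi psi : hom G H) :
  L_adj phi psi <->
  forall (R : tau) x (y : (arity R).-tuple H), interp G R x ->
    (forall i, tnth y i = phi (tnth x i) \/ tnth y i = psi (tnth x i)) ->
    interp H R y.
Proof.
split=> [Lpp R x y Gx yE|Lpp R x Gx gamma gE]; last first.
  apply: Lpp Gx _ => i; rewrite tnth_mktuple.
  by case: (gE i) => ->; [left | right].
pose gamma i := if pselect (tnth y i = phi (tnth x i)) then phi else psi.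
have gE i : gamma i = phi \/ gamma i = psi.
  by rewrite /gamma; case: pselect; [left | right].
apply: interp_ext (Lpp R x Gx gamma gE) => i.
by rewrite tnth_mktuple /gamma; case: pselect => //; case: (yE i).
Qed.

Lemma L_adj_refl G H (phi : hom G H) : L_adj phi phi.
Proof.
apply/L_adjP => R x y Gx yE; apply: (hom_interp_tnth (f := phi) Gx) => i.
by case: (yE i).
Qed.

Lemma L_adj_sym G H (phi psi : hom G H) : L_adj phi psi -> L_adj psi phi.
Proof.
move=> /L_adjP Lpp; apply/L_adjP => R x y Gx yE; apply: Lpp Gx _ => i.
by case: (yE i); [right | left].
Qed.

Lemma L_adj_compl G H K (g : hom H K) (u v : hom G H) :
  L_adj u v -> L_adj (hom_comp g u) (hom_comp g v).
Proof.
move=> /L_adjP Luv; apply/L_adjP => R x y Gx yE.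
have /choice[z zP] : forall i : 'I_(arity R), exists z, g z = tnth y i /\
    (z = u (tnth x i) \/ z = v (tnth x i)).
  move=> i; case: (yE i) => ->; [exists (u (tnth x i)) | exists (v (tnth x i))].
    by split=> //; left.
  by split=> //; right.
have /(hom_interp g) : interp H R [tuple z i | i < arity R].
  by apply: Luv Gx _ => i; rewrite tnth_mktuple; case: (zP i).
by apply: interp_ext => i; rewrite tnth_map tnth_mktuple; case: (zP i).
Qed.

Lemma L_adj_compr G H K (u : hom G H) (f g : hom H K) :
  L_adj f g -> L_adj (hom_comp f u) (hom_comp g u).
Proof.
move=> /L_adjP Lfg; apply/L_adjP => R x y Gx yE.
apply: Lfg (hom_interp u Gx) _ => i; rewrite tnth_map; exact: yE.
Qed.

Lemma L_adj_pair G H1 H2 (f f' : hom G H1) (g g' : hom G H2) :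
  L_adj f f' -> L_adj g g' -> L_adj (hom_pair f g) (hom_pair f' g').
Proof.
move=> /L_adjP Lf /L_adjP Lg; apply/L_adjP => R x y Gx yE; split.
  by apply: Lf Gx _ => i; rewrite tnth_map; case: (yE i) => ->; [left|right].
by apply: Lg Gx _ => i; rewrite tnth_map; case: (yE i) => ->; [left|right].
Qed.

Definition lipschitz G (h : G -> nat) : Prop :=
  forall (R : tau) t, interp G R t ->
  forall i j, h (tnth t i) <= (h (tnth t j)).+1.

(** Arities are positive, so [h] attains a minimum [d] over the entries, and no entry exceeds it by
    more than one. *)
Lemma lipschitz_range G (h : G -> nat) (R : tau) t :
  lipschitz h -> interp G R t ->
  exists d, forall i, h (tnth t i) = d \/ h (tnth t i) = d.+1.
Proof.
move=> hlip Gt; pose i0 := Ordinal (arity_gt0 R).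
case: (@arg_minnP _ i0 xpredT (fun i => h (tnth t i))) => // i _ imin.
exists (h (tnth t i)) => j; have := imin j isT.
rewrite leq_eqVlt => /orP[/eqP ->|lt]; first by left.
by right; apply/eqP; rewrite eqn_leq lt (hlip _ _ Gt).
Qed.

(** Along one tuple only two consecutive members of [f] are used, and these are adjacent in L. *)
Lemma glue_hom G K H (f : nat -> hom K H) (u : hom G K) (h : G -> nat) :
  (forall j, L_adj (f j) (f j.+1)) -> lipschitz h ->
  exists v : hom G H, forall x, v x = f (h x) (u x).
Proof.
move=> fL hlip; apply: mk_hom => R t y Gt yE.
have [d hd] := lipschitz_range hlip Gt.
have /L_adjP Lfd := fL d; apply: Lfd (hom_interp u Gt) _.
by move=> i; rewrite yE tnth_map; case: (hd i) => ->; [left | right].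
Qed.

Lemma L_joined_seq G H (u v : hom G H) : joined_by_walk L_adj u v ->
  exists l (f : nat -> hom G H),
  [/\ f 0 = u, forall j, l <= j -> f j = v & forall j, L_adj (f j) (f j.+1)].
Proof.
move=> uv; have [l [f [f0 fl fL]]] := joined_seq uv; exists l, f; split=> // j.
have [/fL//|lj] := ltnP j l.
by rewrite !fl ?(leqW lj)//; exact: L_adj_refl.
Qed.

Lemma C_adj1_eq G H (phi psi : hom G H) (x0 : G) :
  (forall x, x <> x0 -> phi x = psi x) -> C_adj 1 phi psi.
Proof.
move=> E; rewrite /C_adj.
have le1 : ([set x | phi x <> psi x] #<= [set x0])%card.
  by apply: subset_card_le => x /= ne; apply: contrapT => /E.
apply: (card_le_trans le1).
have := @card_set1 _ x0; rewrite card_eq_le => /andP[-> _] //.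
Qed.

Lemma C_adj_sym n G H (phi psi : hom G H) : C_adj n phi psi -> C_adj n psi phi.
Proof.
rewrite /C_adj => le; rewrite (_ : [set x | _] = [set x | phi x <> psi x])//.
by apply/seteqP; split=> x /= /nesym.
Qed.

(** Adjacency in L makes every pointwise mixture of [phi] and [psi] a homomorphism, so the finitely
    many points of difference can be switched one by one. *)
Lemma L_adj_joined_C G H (phi psi : hom G H) :
  L_adj phi psi -> finite_set [set x | phi x <> psi x] ->
  joined_by_walk (C_adj 1) phi psi.
Proof.
move=> /L_adjP Lpp /finite_set_seq[s sP].
have mix (r : seq {classic G}) : exists v : hom G H,
    forall x, v x = if (x : {classic G}) \in r then psi x else phi x.
  apply: mk_hom => R t y Gt yE; apply: Lpp Gt _ => i; rewrite yE.
  by case: ifP; [right | left].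
suff {sP} main (r : seq {classic G}) (v : hom G H) :
    (forall x, v x = if (x : {classic G}) \in r then psi x else phi x) ->
    joined_by_walk (C_adj 1) phi v.
  apply: (main s) => x; case: ifPn => // /negP xs.
  by apply: contrapT => /nesym/sP.
elim: r v => [|x0 r IH] v vE.
  have -> : v = phi by apply: hom_ext => x; rewrite vE.
  exact: rt_refl.
have [w wE] := mix r; apply: rt_trans (IH w wE) _; apply: rt_step.
apply: (@C_adj1_eq _ _ _ _ x0) => x xx0.
by rewrite wE vE inE; case: eqP.
Qed.

End Homomorphisms.

(** * Dismantling and retractions *)

Section Dismantling.
Variable tau : signature.
Implicit Types G H K : structure tau.

(** Dismantling is recorded on universes alone: all members of a sequence that starts at an induced
    substructure are induced. *)
Definition dstep H (X Y : set H) : Prop := exists a b,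
  [/\ X a, X b, a <> b, dominates (induced X) b a & Y = X `\ a].

Lemma sub_ext H (J K : substructure H) :
  suniv J = suniv K -> (forall R, srel J (R := R) = srel K (R := R)) -> J = K.
Proof.
case: J K => X r p q [Y r' p' q'] /= XY rr'.
have {}rr' : r = r' by apply: functional_extensionality_dep.
by subst Y r'; congr Substructure; exact: Prop_irrelevance.
Qed.

Lemma is_induced_in_induced H (X Y : set H) (K : substructure H) : Y `<=` X ->
  is_induced_in (induced X) Y K <-> K = induced Y.
Proof.
move=> YX; have YE R : srel (induced Y) (R := R) =
    [set a | srel (induced X) a /\ forall i, Y (tnth a i)].
  apply/seteqP; split=> t /=; last by case=> [[]].
  by move=> [Ht Yt]; split=> //; split=> // i; apply: YX.
split=> [[KY KR]|->]; last by split.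
by apply: sub_ext => // R; rewrite KR YE.
Qed.

Lemma dismantles_inducedP H (X : set H) (K : substructure H) :
  dismantles_to (induced X) K <->
  exists Y, K = induced Y /\ joined_by_walk (@dstep H) X Y.
Proof.
split=> [[l [S [SD S0 <-]]]|[Y [-> XY]]].
  elim: l SD => [_|l IH SD]; first by exists X; split; [|exact: rt_refl].
  have [j jl|Y [SY XY]] := IH; first by apply: SD; exact: ltnW.
  have [a [b []]] := SD l (ltnSn l); rewrite SY /= => Ya Yb ab dom.
  move=> /is_induced_in_induced ind; exists (Y `\ a); split.
    by apply: ind; exact: subDsetl.
  by apply: rt_trans XY _; apply: rt_step; exists a, b.
have [l [f [f0 fl fD]]] := joined_seq XY.
exists l, (fun j => induced (f j)); split; rewrite ?f0 ?fl//.
move=> j /fD[a [b [fa fb ab dom ->]]]; exists a, b; split=> //.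
by apply/is_induced_in_induced => //; exact: subDsetl.
Qed.

Lemma dstep_subset H (X Y : set H) : joined_by_walk (@dstep H) X Y -> Y `<=` X.
Proof.
elim=> [{}X {}Y [a [b [_ _ _ _ ->]]]|X1|X1 X2 X3 _ X21 _ X32] //.
exact: subset_trans X32 X21.
Qed.

(** Domination changes one entry; iterated over the positions, it replaces any chosen part of the
    occurrences of [a] by [b]. *)
Lemma dominates_subst H (J : substructure H) b a (R : tau)
    (s y : (arity R).-tuple H) :
  dominates J b a -> srel J s ->
  (forall i, tnth y i = tnth s i \/ tnth s i = a /\ tnth y i = b) ->
  srel J y.
Proof.
move=> dom Js yE.
(* The list [l] holds the positions already treated. *)
suff main (l : seq 'I_(arity R)) :
    srel J [tuple if i \in l then tnth y i else tnth s i | i < arity R].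
  rewrite (_ : y = [tuple if i \in enum 'I_(arity R) then tnth y i else
                          tnth s i | i < arity R]); first exact: main.
  by apply: eq_from_tnth => i; rewrite tnth_mktuple mem_enum.
elim: l => [|i l IH].
  rewrite (_ : mktuple _ = s)//.
  by apply: eq_from_tnth => j; rewrite tnth_mktuple.
have [il|il] := boolP (i \in l).
  rewrite (_ : mktuple _ = [tuple if i \in l then tnth y i else
                                  tnth s i | i < arity R])//.
  by apply: eq_from_tnth => j; rewrite !tnth_mktuple inE; case: eqP => // ->;
    rewrite il.
have [yi|[si yi]] := yE i.
  rewrite (_ : mktuple _ = [tuple if i \in l then tnth y i else
                                  tnth s i | i < arity R])//.
  apply: eq_from_tnth => j; rewrite !tnth_mktuple inE; case: eqP => // ->.
  by rewrite (negbTE il) yi.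
rewrite (_ : mktuple _ = tuple_subst [tuple if i \in l then tnth y i else
                                  tnth s i | i < arity R] i b).
  by apply: dom IH _; rewrite tnth_mktuple (negbTE il).
by apply: eq_from_tnth => j; rewrite !tnth_mktuple inE; case: eqP => // ->.
Qed.

(** [Y] is meant to be the final universe of a dismantling, even for its early folds: as no fold
    moves a value in [Y], neither does their composite. *)
Definition L_fix G H (Y : set H) (v w : hom G H) : Prop :=
  L_adj v w /\ forall x, Y (v x) -> w x = v x.

(** The witness is [u] followed by the fold of [a] onto [b]; a tuple mixing both maps arises from an
    image under [u] by turning some entries [a] into [b]. *)
Lemma dstep_fold H (X Y : set H) G (u : hom G H) :
  dstep X Y -> (forall x, X (u x)) ->
  exists2 v : hom G H, forall x, Y (v x) & L_fix Y u v.
Proof.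
move=> [a [b [Xa Xb ab dom ->]]] Xu.
have fold (R : tau) t (y : (arity R).-tuple H) : interp G R t ->
    (forall i, tnth y i = u (tnth t i) \/ u (tnth t i) = a /\ tnth y i = b) ->
    interp H R y.
  move=> Gt yE; have := @dominates_subst _ _ _ _ _ (map_tuple u t) y dom.
  case=> //.
    split; first exact: hom_interp.
    by move=> i; rewrite tnth_map.
  by move=> i; rewrite tnth_map.
have [v vE] : exists v : hom G H,
    forall x, v x = if pselect (u x = a) then b else u x.
  apply: mk_hom => R t y Gt yE; apply: fold Gt _ => i; rewrite yE.
  by case: pselect; [right | left].
exists v; first by move=> x; rewrite vE; case: pselect => //= ?; split=> // /esym.
split=> [|x [Xx ux]]; last by rewrite vE; case: pselect.
apply/L_adjP => R t y Gt yE; apply: fold Gt _ => i.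
by case: (yE i) => ->; rewrite ?vE; [left | case: pselect; [right | left]].
Qed.

(** The folds are composed along the dismantling. When [u] is the identity and [X] is everything,
    [v] is a retraction onto [Y] joined to the identity in L. *)
Lemma dstep_retract H (X Y : set H) G (u : hom G H) :
  joined_by_walk (@dstep H) X Y -> (forall x, X (u x)) ->
  exists2 v : hom G H, forall x, Y (v x) & joined_by_walk (L_fix Y) u v.
Proof.
move=> XY; have {}XY := clos_rt_rt1n _ _ _ _ XY.
elim: XY u => {X Y} [X u Xu|X Z Y XZ ZY IH u Xu]; first by exists u; [|exact: rt_refl].
have [v Zv [Luv uv]] := dstep_fold XZ Xu.
have [w Yw vw] := IH v Zv; exists w => //.
apply: rt_trans vw; apply: rt_step; split=> // x Yux; apply: uv.
by apply: dstep_subset Yux; exact: clos_rt1n_rt.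
Qed.

Lemma L_fix_joined G H (Y : set H) (u v : hom G H) :
  joined_by_walk (L_fix Y) u v ->
  joined_by_walk L_adj u v /\ forall x, Y (u x) -> v x = u x.
Proof.
elim=> [x y [Lxy fxy]|x|x y z _ [xy fxy] _ [yz fyz]].
- by split=> //; exact: rt_step.
- by split=> //; exact: rt_refl.
- split=> [|p Yp]; first exact: rt_trans xy yz.
  by rewrite fyz fxy.
Qed.

(** Here [e] is an isomorphism onto an induced substructure: every tuple over the image of [Z] lifts
    to [G], where the domination applies. *)
Lemma dstep_embed G H (e : G -> H) (Z Z' : set G) :
  injective e -> (forall (R : tau) t, interp G R t <-> interp H R (map_tuple e t)) ->
  dstep Z Z' -> dstep (e @` Z) (e @` Z').
Proof.
move=> einj eR [a [b [Za Zb ab dom ->]]]; exists (e a), (e b); split.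
- by exists a.
- by exists b.
- by move=> /einj.
- move=> R i t [Ht Zt] ti.
  have /choice[s sP] : forall j, exists s, Z s /\ e s = tnth t j.
    by move=> j; have [s Zs es] := Zt j; exists s.
  pose s' := [tuple s j | j < arity R].
  have es' : map_tuple e s' = t.
    by apply: eq_from_tnth => j; rewrite tnth_map tnth_mktuple; case: (sP j).
  have [||Gs Zs] := dom R i s'.
  + split; first by apply/eR; rewrite es'.
    by move=> j; rewrite tnth_mktuple; case: (sP j).
  + by apply: einj; rewrite -ti tnth_mktuple; case: (sP i).
  have subE : map_tuple e (tuple_subst s' i b) = tuple_subst t i (e b).
    apply: eq_from_tnth => j; rewrite -es' tnth_map !tnth_mktuple tnth_map.
    by rewrite tnth_mktuple; case: eqP.
  rewrite -subE; split; first exact/eR.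
  by move=> j; rewrite tnth_map; exists (tnth (tuple_subst s' i b) j).
- apply/seteqP; split=> [_ [x [Zx xa] <-]|_ [[x Zx <-] xa]].
    by split; [exists x | move=> /einj].
  by exists x => //; split=> // E; apply: xa; rewrite E.
Qed.

(** For each [c] in [Z] the point [(b, c)] dominates [(a, c)], so the fibre over [a] is removed
    point by point along an enumeration of [Z]. *)
Lemma dstep_product_l H K (X Y : set H) (Z : set K) :
  finite_set Z -> dstep X Y ->
  joined_by_walk (@dstep (product H K)) (X `*` Z) (Y `*` Z).
Proof.
move=> /finite_set_seq[s sP] [a [b [Xa Xb ab dom ->]]].
pose S (r : seq {classic K}) : set (product H K) :=
  [set p | [/\ X p.1, Z p.2 & ~ (p.1 = a /\ (p.2 : {classic K}) \in r)]].
have S0 : S [::] = X `*` Z.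
  by apply/seteqP; split=> p; [case | case=> ? ?; split=> // -[]].
have S1 : S s = (X `\ a) `*` Z.
  apply/seteqP; split=> p.
    case=> Xp Zp ns; split=> //; split=> // pa; apply: ns; split=> //.
    exact/sP.
  by case=> -[Xp pa] Zp; split=> // -[].
suff main (r : seq {classic K}) : {subset r <= s} ->
    joined_by_walk (@dstep (product H K)) (S [::]) (S r).
  by rewrite -S0 -S1; exact: main.
elim: r => [_|c r IH rs]; first exact: rt_refl.
have {}IH : joined_by_walk (@dstep (product H K)) (S [::]) (S r).
  by apply: IH => x xr; apply: rs; rewrite inE xr orbT.
have [cr|cr] := boolP (c \in r).
  rewrite (_ : S (c :: r) = S r)//; apply/seteqP; split=> p -[Xp Zp np];
    split=> // -[pa pr]; apply: np; split=> //; first by rewrite inE pr orbT.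
  by move: pr; rewrite inE => /orP[/eqP ->|].
apply: rt_trans IH _; apply: rt_step.
have Zc : Z c by apply/sP; apply: rs; rewrite inE eqxx.
exists (a, c), (b, c); split.
- by split=> //= -[_]; rewrite (negbTE cr).
- by split=> //= -[/esym].
- by case.
- move=> R i t [[Ht Kt] St] ti.
  have [||Hs Xs] := dom R i (map_tuple fst t).
  + by split=> // j; rewrite tnth_map; case: (St j).
  + by rewrite tnth_map ti.
  split; first split.
  + apply: interp_ext Hs => j; rewrite !(tnth_map, tnth_ord_tuple).
    by case: eqP.
  + apply: interp_ext Kt => j; rewrite !(tnth_map, tnth_ord_tuple).
    by case: eqP => // ->; rewrite ti.
  + move=> j; rewrite tnth_mktuple; case: eqP => // _.
    by split=> //= -[/esym].
- apply/seteqP; split=> -[p q].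
    case=> /= Xp Zp np; split.
      by split=> //= -[pa qr]; apply: np; rewrite inE qr orbT.
    by case=> pa qc; apply: np; rewrite inE qc eqxx.
  case=> -[/= Xp Zp np] pq; split=> //= -[pa].
  rewrite inE => /orP[/eqP qc|qr]; first by apply: pq; rewrite pa qc.
  exact: np.
Qed.

Lemma dstep_product_r H K (X Y : set H) (Z : set K) :
  finite_set Z -> dstep X Y ->
  joined_by_walk (@dstep (product K H)) (Z `*` X) (Z `*` Y).
Proof.
move=> Zfin XY; pose e (p : product H K) : product K H := (p.2, p.1).
have eE (A : set H) : Z `*` A = e @` (A `*` Z).
  apply/seteqP; split=> [[z x] [/= Zz Ax]|_ [[x z] [/= Ax Zz] <-]//].
  by exists (x, z).
rewrite !eE; apply: (joined_map (F := fun A => e @` A)) (dstep_product_l Zfin XY).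
have einj : injective e by move=> [x z] [x' z'] [-> ->].
move=> A B AB; apply: rt_step; apply: dstep_embed einj _ AB => R t.
split=> -[t1 t2]; split; [move: t2 | move: t1 | move: t2 | move: t1];
  by apply: interp_ext => i; rewrite !tnth_map.
Qed.

(** Each removal from [A] to [B] is carried out in the left factor and then in the right one,
    passing through [B]*[A]. *)
Lemma dstep_square H (X : set H) : is_finite H ->
  joined_by_walk (@dstep H) setT X ->
  joined_by_walk (@dstep (square H)) setT (X `*` X).
Proof.
move=> Hfin XT; rewrite -setXTT; apply: (@joined_map _ _ _ _ (fun A => A `*` A)) XT.
have fin (A : set H) : finite_set A by apply: sub_finite_set Hfin.
move=> A B AB; apply: rt_trans (dstep_product_r (fin B) AB).
exact: dstep_product_l.
Qed.

(** Dominated points outside [P] are removed greedily, by induction on the length of a list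
    containing them. [P] will be empty for H and the diagonal for a square. *)
Lemma dismantle_max H (X P : set H) : finite_set X -> P `<=` X ->
  exists Y, [/\ joined_by_walk (@dstep H) X Y, P `<=` Y &
    forall a b, Y a -> Y b -> ~ P a -> dominates (induced Y) b a -> b = a].
Proof.
move=> /finite_set_seq[s sP] PX.
have {sP} : forall x, X x -> ~ P x -> (x : {classic H}) \in s by move=> x /sP.
have [n] := ubnP (size s); elim: n s X PX => // n IH s X PX sn sX.
have [stiff|] :=
  pselect (forall a b, X a -> X b -> ~ P a -> dominates (induced X) b a -> b = a).
  by exists X; split=> //; exact: rt_refl.
move=> /existsNP[a /existsNP[b]].
move=> /not_implyP[Xa] /not_implyP[Xb] /not_implyP[Pa] /not_implyP[dom ba].
have [|||Y [XY PY Ystiff]] :=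
    IH [seq x <- s | x != (a : {classic H})] (X `\ a).
- by move=> x Px; split; [exact: PX | move=> xa; apply: Pa; rewrite -xa].
- rewrite size_filter -ltnS; apply: leq_trans sn.
  rewrite ltnS -(count_predC (pred1 (a : {classic H}))) -add1n leq_add2r.
  by rewrite -has_count has_pred1; exact: sX.
- by move=> x [Xx xa] Px; rewrite mem_filter sX// andbT; exact/eqP.
exists Y; split=> //; apply: rt_trans XY; apply: rt_step.
by exists a, b; split=> //; exact/nesym.
Qed.

End Dismantling.

(** * Distances and gluing along Lipschitz heights *)

Section Distances.
Variable tau : signature.
Implicit Types G H K : structure tau.

Lemma at_least_min_nat (P : set nat) g :
  at_least (min_nat P) g <-> forall n, P n -> g <= n.
Proof.
rewrite /min_nat; case: pselect => [exP|nP] /=; last first.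
  by split=> // _ n Pn; case: nP; exists n; exact/asboolP.
case: ex_minnP => m /asboolP Pm mmin; split=> [gm n Pn|]; last exact.
by apply: leq_trans gm _; apply: mmin; exact/asboolP.
Qed.

Lemma min_nat_le (P : set nat) n : P n ->
  exists2 m, min_nat P = Some m & m <= n.
Proof.
move=> Pn; rewrite /min_nat; case: pselect => [exP|[]]; last first.
  by exists n; exact/asboolP.
by case: ex_minnP => m _ mmin; exists m => //; apply: mmin; exact/asboolP.
Qed.

Lemma min_nat_in (P : set nat) m : min_nat P = Some m -> P m.
Proof.
by rewrite /min_nat; case: pselect => // exP; case: ex_minnP => k /asboolP Pk _ [<-].
Qed.

Lemma at_least_dist_set H (V W : set H) g : at_least (dist_set V W) g <->
  forall w : walk H, V (walk_start w) -> W (walk_end w) -> g <= walk_length w.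
Proof.
rewrite at_least_min_nat; split=> [gd w Vw Ww|gd n [a [b [Va Wb ab]]]].
  have [|m dm mw] := @min_nat_le [set n | exists w' : walk H,
    [/\ walk_start w' = walk_start w, walk_end w' = walk_end w &
        walk_length w' = n]] (walk_length w).
    by exists w.
  by apply: leq_trans mw; apply: gd; exists (walk_start w), (walk_end w).
have [w [wa wb <-]] := min_nat_in ab.
by apply: gd; rewrite ?wa ?wb.
Qed.

Lemma lipschitz_walk H (h : H -> nat) (w : walk H) : lipschitz h ->
  h (walk_end w) <= h (walk_start w) + walk_length w.
Proof.
move=> hlip; case: w => a s; rewrite /walk_end /walk_length /=.
elim: s a => [|e s IH] a /=; first by rewrite addn0.
case=> He _ <- /IH; have := hlip _ _ He (step_out e) (step_in e).
lia.
Qed.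

Lemma is_walk_rcons H (a : H) s e : is_walk a (rcons s e) <->
  is_walk a s /\ [/\ interp H (step_sym e) (step_tuple e), step_in e != step_out e &
    tnth (step_tuple e) (step_in e) =
    last a [seq tnth (step_tuple e') (step_out e') | e' <- s]].
Proof.
elim: s a => [|e' s IH] a /=.
  by split=> [[? ? ? _]|[_ [? ? ?]]].
by split=> [[? ? ? /IH[? ?]]|[[? ? ? ?] ?]]; split=> //; exact/IH.
Qed.

Lemma walk_extend H (w : walk H) (R : tau) (a : (arity R).-tuple H) i j :
  interp H R a -> walk_end w = tnth a i -> i != j ->
  exists w' : walk H, is_extension w (Step a i j) w'.
Proof.
move=> Ha wi ij; have ew : is_walk (walk_start w) (rcons (walk_steps w) (Step a i j)).
  by apply/is_walk_rcons; split; [exact: walkP | split].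
by exists (Walk ew).
Qed.

Lemma extension_end H (w w' : walk H) e :
  is_extension w e w' -> walk_end w' = tnth (step_tuple e) (step_out e).
Proof. by case=> [ws we]; rewrite /walk_end ws we map_rcons last_rcons. Qed.

Lemma extension_length H (w w' : walk H) e :
  is_extension w e w' -> walk_length w' = (walk_length w).+1.
Proof. by case=> [_ we]; rewrite /walk_length we size_rcons. Qed.

Lemma walk_length_lipschitz H : lipschitz (@walk_length tau H : walk_forest H -> nat).
Proof.
move=> R t [a [k [Ha wk ext]]].
have len i : i = k \/
    walk_length (tnth t i) = (walk_length (tnth t k)).+1.
  by have [->|/ext/extension_length ->] := eqVneq i k; [left | right].
by move=> i j; case: (len i) => ->; case: (len j) => ->; lia.
Qed.

Lemma walk_end_interp H (R : tau) a : interp (walk_forest H) R a ->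
  interp H R (map_tuple (@walk_end tau H) a).
Proof.
case=> [b [k [Hb wk ext]]]; apply: interp_ext Hb => i; rewrite tnth_map.
by have [->|/ext/extension_end ->] := eqVneq i k.
Qed.

Definition hom_walk_end H : hom (walk_forest H) H := Hom (@walk_end_interp H).

(** The ball of radius [n] around [V], grown by tuples rather than walks, so that finiteness and the
    Lipschitz bound follow by induction. *)
Fixpoint nbhd G (V : set G) n : set G :=
  if n is m.+1 then
    nbhd V m `|` [set y | exists (R : tau) t i j,
      [/\ interp G R t, tnth t i = y & nbhd V m (tnth t j)]]
  else V.

Lemma nbhd_tuple G (V : set G) n (R : tau) t i j :
  interp G R t -> nbhd V n (tnth t j) -> nbhd V n.+1 (tnth t i).
Proof. by move=> Gt Vj; right; exists R, t, i, j. Qed.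

Lemma nbhd0_subset G (V : set G) n : V `<=` nbhd V n.
Proof. by elim: n => // n IH x /IH; left. Qed.

Lemma nbhd_walk G (V : set G) n x : nbhd V n x ->
  exists w : walk G, [/\ V (walk_start w), walk_end w = x & walk_length w <= n].
Proof.
elim: n x => [|n IH] x.
  by move=> Vx; have xw : is_walk x [::] by []; exists (Walk xw).
case=> [/IH[w [Vw wx wn]]|[R [t [i [j [Gt <- /IH[w [Vw wx wn]]]]]]]].
  by exists w; split=> //; exact: leqW.
have [ij|ij] := eqVneq j i; first by exists w; rewrite -ij; split=> //; exact: leqW.
have [w' w'E] := walk_extend Gt wx ij; exists w'; split.
- by case: w'E => ->.
- by rewrite (extension_end w'E).
- by rewrite (extension_length w'E).
Qed.

(** Every new point is an entry of one of the finitely many tuples meeting the previous ball. *)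
Lemma finite_nbhd G (V : set G) n :
  locally_finite G -> finite_set V -> finite_set (nbhd V n).
Proof.
move=> Gfin Vfin; elim: n => //= n IH; rewrite finite_setU; split=> //.
apply: (@sub_finite_set _ _ (\bigcup_(x in nbhd V n) \bigcup_(p in incident_tuples x)
  [set tnth (tagged p) i | i in [set: 'I_(arity (tag p))]])).
  move=> y [R [t [i [j [Gt <- Vj]]]]]; exists (tnth t j) => //.
  exists (existT (fun R : tau => (arity R).-tuple G) R t); last by exists i.
  by split=> //; exists j.
by apply: bigcup_finite => // x _; apply: bigcup_finite => // p _; exact: finite_image.
Qed.

(* Equals l - dist(x, V), truncated at 0. *)
Definition depth G (V : set G) l (x : G) : nat := \sum_(n < l) `[< nbhd V n x >].

(** If one entry lies in the ball of radius [n], all entries lie in the ball of radius [n.+1]; this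
    shift of the sum costs a single summand, at most one. *)
Lemma depth_lipschitz G (V : set G) l : lipschitz (depth V l).
Proof.
move=> R t Gt i j; rewrite /depth.
set F := fun n => nat_of_bool `[< nbhd V n (tnth t j) >].
have le : \sum_(n < l) `[< nbhd V n (tnth t i) >] <= \sum_(n < l) F n.+1.
  apply: leq_sum => n _; rewrite /F; case: asboolP => // Vi.
  by rewrite (asboolT (nbhd_tuple j Gt Vi)).
apply: leq_trans le _; apply: (@leq_trans (\sum_(n < l.+1) F n)).
  by rewrite big_ord_recl /=; exact: leq_addl.
by rewrite big_ord_recr /= -addn1 leq_add2l leq_b1.
Qed.

Lemma depth_le G (V : set G) l x : depth V l x <= l.
Proof.
rewrite /depth -[leqRHS](card_ord l) -sum1_card; apply: leq_sum => n _.
exact: leq_b1.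
Qed.

Lemma depth_in G (V : set G) l x : V x -> depth V l x = l.
Proof.
move=> Vx; rewrite /depth -[RHS](card_ord l) -sum1_card; apply: eq_bigr => n _.
by rewrite asboolT//; exact: nbhd0_subset.
Qed.

Lemma depth_out G (V : set G) l x : ~ (exists2 n, n < l & nbhd V n x) ->
  depth V l x = 0.
Proof.
move=> Vx; rewrite /depth big1// => n _; rewrite asboolF// => Vn.
by apply: Vx; exists n.
Qed.

Lemma lipschitz_sub G (h : G -> nat) l :
  lipschitz h -> lipschitz (fun x => l - h x).
Proof. by move=> hlip R t Gt i j; have := hlip R t Gt j i; lia. Qed.

(** The height [l - depth V l x] is the distance to [V] capped at [l]: it is 0 on [V] and [l] on
    [W]. *)
Lemma L_joined_mixing K H (f : nat -> hom K H) l G (u : hom G K) (phi psi : hom G H)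
    (V W : set G) :
  (forall j, L_adj (f j) (f j.+1)) ->
  (forall x, f 0 (u x) = phi x) -> (forall x, f l (u x) = psi x) ->
  at_least (dist_set V W) l ->
  exists gamma : hom G H,
    (forall x, V x -> gamma x = phi x) /\ (forall x, W x -> gamma x = psi x).
Proof.
move=> fL f0 fl /at_least_dist_set VW.
have [v vE] := glue_hom u fL (lipschitz_sub l (depth_lipschitz V l)).
exists v; split=> x xP; rewrite vE; first by rewrite depth_in// subnn.
rewrite depth_out ?subn0// => -[n nl /nbhd_walk[w [Vw wx wn]]].
have := VW w Vw; rewrite wx => /(_ xP) lw.
by have := leq_ltn_trans (leq_trans lw wn) nl; rewrite ltnn.
Qed.

(** Capping the height at [j] = 0, ..., [l] interpolates between [phi] and [psi]. Consecutive stages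
    are adjacent in L and differ only on the finite support of [h], hence are joined in C. *)
Lemma L_joined_C_joined K H (f : nat -> hom K H) l G (u : hom G K) (h : G -> nat)
    (phi psi : hom G H) :
  (forall j, L_adj (f j) (f j.+1)) -> lipschitz h -> (forall x, h x <= l) ->
  finite_set [set x | h x <> 0] ->
  (forall x, phi x = f 0 (u x)) -> (forall x, psi x = f (h x) (u x)) ->
  joined_by_walk (C_adj 1) phi psi.
Proof.
move=> fL hlip hl hfin phiE psiE.
have /choice[chi chiE] : forall j, exists v : hom G H,
    forall x, v x = f (minn (h x) j) (u x).
  move=> j; apply: glue_hom => // R t Gt i k.
  by have := hlip R t Gt i k; lia.
have -> : phi = chi 0 by apply: hom_ext => x; rewrite chiE minn0.
have -> : psi = chi l by apply: hom_ext => x; rewrite chiE (minn_idPl (hl x)).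
(* A walk whose steps are themselves walks in C is flattened. *)
apply: (joined_map (F := id) (A := fun v w => joined_by_walk (C_adj 1) v w)) => //.
apply: seq_joined => j _; apply: L_adj_joined_C; last first.
  apply: sub_finite_set hfin => x /=; rewrite !chiE => ne hx; apply: ne.
  by rewrite hx !min0n.
apply/L_adjP => R t y Gt yE; have [d hd] := lipschitz_range hlip Gt.
(* On this tuple the heights capped at [j] or at [j.+1] only take the values [minn d j] and its
   successor. *)
have /L_adjP Lfd := fL (minn d j); apply: Lfd (hom_interp u Gt) _ => i.
rewrite tnth_map; case: (yE i) => ->; rewrite chiE.
- have [->|->] : minn (h (tnth t i)) j = minn d j \/
    minn (h (tnth t i)) j = (minn d j).+1 by case: (hd i) => ->; lia.
    by left.
  by right.
- have [->|->] : minn (h (tnth t i)) j.+1 = minn d j \/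
    minn (h (tnth t i)) j.+1 = (minn d j).+1 by case: (hd i) => ->; lia.
    by left.
  by right.
Qed.

End Distances.

(** * L-walks between the projections *)

Section Slices.
Variable tau : signature.
Implicit Types G H P : structure tau.

(** The points [p] and [q] span a copy of the 1-link, or a single looped point if they coincide. *)
Definition looped P (p q : P) : Prop :=
  forall (R : tau) t, (forall i, tnth t i = p \/ tnth t i = q) -> interp P R t.

Lemma slice P G H (Phi : hom (product P G) H) (p : P) : looped p p ->
  exists u : hom G H, forall x, u x = Phi (p, x).
Proof.
move=> pp; apply: mk_hom => R t y Gt yE.
have := @hom_interp_tnth _ _ _ Phi R [tuple (p, tnth t i) | i < arity R] y.
apply; last by move=> i; rewrite tnth_mktuple yE.
split; first by apply: pp => i; rewrite tnth_map tnth_mktuple; left.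
by apply: interp_ext Gt => i; rewrite tnth_map tnth_mktuple.
Qed.

Lemma slice_L_adj P G H (Phi : hom (product P G) H) (p q : P) (u v : hom G H) :
  looped p q -> (forall x, u x = Phi (p, x)) -> (forall x, v x = Phi (q, x)) ->
  L_adj u v.
Proof.
move=> pq uE vE; apply/L_adjP => R t y Gt yE.
have /choice[r rP] : forall i, exists r, (r = p \/ r = q) /\
    tnth y i = Phi (r, tnth t i).
  move=> i; case: (yE i) => ->; first by exists p; split=> //; left.
  by exists q; split=> //; right.
have := @hom_interp_tnth _ _ _ Phi R [tuple (r i, tnth t i) | i < arity R] y.
apply; last by move=> i; rewrite tnth_mktuple; case: (rP i).
split; last by apply: interp_ext Gt => i; rewrite tnth_map tnth_mktuple.
by apply: pq => i; rewrite tnth_map tnth_mktuple; case: (rP i).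
Qed.

(** A 1-link with [T] as set of points; for [bool] it is convertible to [one_link]. *)
Definition link (T : Type) : structure tau :=
  @Structure tau T (fun R => [set: (arity R).-tuple T]).

(** A change at [n] points or fewer leaves the slice over some [r] intact. In L, slice [p] of [Phi]
    is adjacent to this common slice, which is adjacent to slice [q] of [Psi]. *)
Lemma link_slices_joined (T : Type) n G H (Phi Psi : hom (product (link T) G) H)
    (p q : T) (u v : hom G H) :
  ~~ ([set: T] #<= `I_n)%card ->
  joined_by_walk (C_adj n) Phi Psi ->
  (forall x, u x = Phi (p, x)) -> (forall x, v x = Psi (q, x)) ->
  joined_by_walk L_adj u v.
Proof.
move=> Tn PP; elim: PP p q u v => {Phi Psi} [Phi Psi le|Phi|Phi Psi Xi _ IH1 _ IH2] p q u v uE vE.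
- have [r rE] : exists r : T, forall x : G, Phi (r, x) = Psi (r, x).
    apply: contrapT => /forallNP/= ne; case/negP: Tn; apply: card_le_trans _ le.
    apply: (@card_le_trans _ _ _ (fst @` [set z | Phi z <> Psi z])).
      apply: subset_card_le => r _; have [x rx] : exists x, Phi (r, x) <> Psi (r, x).
        by apply: contrapT => /forallNP/= h; apply: (ne r) => x; apply: contrapT.
      by exists (r, x).
    exact: card_image_le.
  have [w wE] := @slice (link T) _ _ Phi r (fun _ _ _ => I).
  apply: (@rt_trans _ _ _ w); apply: rt_step.
    exact: (@slice_L_adj (link T) _ _ Phi p r).
  apply: (@slice_L_adj (link T) _ _ Psi r q) => // x.
  by rewrite wE rE.
- apply: rt_step; exact: (@slice_L_adj (link T) _ _ Phi p q).
- have [w wE] := @slice (link T) _ _ Psi p (fun _ _ _ => I).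
  exact: rt_trans (IH1 p p u w uE wE) (IH2 p q w v wE vE).
Qed.

Definition reflexive_path : structure tau :=
  @Structure tau nat
    (fun R => [set t | exists d, forall i, tnth t i = d \/ tnth t i = d.+1]).

(** In the product of a path with the square, [pi1] on layer 0 is mixed with [pi2] on the layers
    from [g] on. The path coordinate varies by at most one on a tuple, so these sets are far enough
    apart, and the layers of the mixture form the walk. *)
Lemma irreducible_L_joined H g : is_finite H ->
  (forall G : structure tau, countable [set: G] -> strongly_irreducible G H g) ->
  joined_by_walk L_adj (pi1 H) (pi2 H).
Proof.
move=> Hfin irr; pose G := product reflexive_path (square H).
have Gcount : countable [set: G].
  rewrite -setXTT; apply: countableX; first exact: countableP.
  by rewrite -setXTT; apply: countableX; exact: finite_set_countable.
pose V := [set z : G | z.1 = 0]; pose W := [set z : G | g <= z.1].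
have VW : at_least (dist_set V W) g.
  apply/at_least_dist_set => w Vw Ww; rewrite -[leqRHS]add0n -[X in X + _]Vw.
  apply: leq_trans Ww _; apply: (@lipschitz_walk _ G (fun z => z.1)).
  move=> R t [[d dP] _] i j; have := dP j; have := dP i; rewrite !tnth_map.
  by case=> ->; case=> ->; lia.
have [Phi [PhiV PhiW]] := irr G Gcount V W VW
  (hom_comp (pi1 H) (hom_snd _ _)) (hom_comp (pi2 H) (hom_snd _ _)).
have loop (j : reflexive_path) : looped j j.
  by move=> R t tj; exists j => i; case: (tj i); left.
have loopS (j : reflexive_path) : looped j (j.+1 : reflexive_path).
  by move=> R t tj; exists j.
have /choice[f fE] : forall j, exists u : hom (square H) H,
    forall x, u x = Phi (j, x).
  by move=> j; exact: slice.
have -> : pi1 H = f 0 by apply: hom_ext => x; rewrite fE PhiV.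
have -> : pi2 H = f g by apply: hom_ext => x; rewrite fE (PhiW (g, x) (leqnn g)).
by apply: seq_joined => j _; exact: slice_L_adj (loopS j) (fE _) (fE _).
Qed.

End Slices.

(** * Squares, their diagonals and retractions *)

Section Squares.
Variable tau : signature.
Implicit Types G H : structure tau.

Definition hom_square G H (f : hom G H) : hom (square G) (square H) :=
  hom_pair (hom_comp f (pi1 G)) (hom_comp f (pi2 G)).

Lemma L_adj_square G H (f g : hom G H) :
  L_adj f g -> L_adj (hom_square f) (hom_square g).
Proof. by move=> fg; apply: L_adj_pair; exact: L_adj_compr. Qed.

(** The projections are the universal pair: composing their walk with the pair of [phi] and [psi]
    gives the walk required. *)
Lemma L_joined_all G H (phi psi : hom G H) :
  joined_by_walk L_adj (pi1 H) (pi2 H) -> joined_by_walk L_adj phi psi.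
Proof.
move=> pp; pose u := hom_pair phi psi.
have -> : phi = hom_comp (pi1 H) u by exact: hom_ext.
have -> : psi = hom_comp (pi2 H) u by exact: hom_ext.
apply: (joined_map (F := fun f => hom_comp f u)) pp => f g fg.
exact/rt_step/L_adj_compr.
Qed.

Lemma L_joined_irreducible H : joined_by_walk L_adj (pi1 H) (pi2 H) ->
  exists g, forall G, strongly_irreducible G H g.
Proof.
move=> /L_joined_seq[l [f [f0 fl fL]]]; exists l => G V W VW phi psi.
apply: (L_joined_mixing (u := hom_pair phi psi)) fL _ _ VW => x.
  by rewrite f0.
by rewrite fl.
Qed.

Lemma interp_sub H (X : set H) (R : tau) t :
  interp (structure_of_sub (induced X)) R t <-> interp H R (map_tuple val t).
Proof.
split=> [[]//|Ht]; split=> // i; rewrite tnth_map; exact: set_valP.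
Qed.

Lemma hom_corestrict G H (X : set H) (u : hom G H) : (forall x, X (u x)) ->
  exists v : hom G (structure_of_sub (induced X)), forall x, val (v x) = u x.
Proof.
move=> Xu; pose f x : structure_of_sub (induced X) := exist _ (u x) (mem_set (Xu x)).
have [v vE] : exists v : hom G (structure_of_sub (induced X)), v =1 f.
  apply: mk_hom => R t y Gt yE; apply/interp_sub.
  apply: (hom_interp_tnth (f := u) Gt) => i.
  by rewrite tnth_map yE.
by exists v => x; rewrite vE.
Qed.

Lemma hom_val_interp H (X : set H) (R : tau) a :
  interp (structure_of_sub (induced X)) R a -> interp H R (map_tuple val a).
Proof. by case. Qed.

Definition hom_val H (X : set H) : hom (structure_of_sub (induced X)) H :=
  Hom (@hom_val_interp H X).

Lemma hom_square_val_inj H (X : set H) : injective (hom_square (hom_val X)).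
Proof. by move=> [a b] [c d] [/val_inj -> /val_inj ->]. Qed.

Lemma interp_square_val H (X : set H) (R : tau) t :
  interp (square (structure_of_sub (induced X))) R t <->
  interp (square H) R (map_tuple (hom_square (hom_val X)) t).
Proof.
split=> [|[t1 t2]]; first exact: hom_interp.
by split; apply/interp_sub; [move: t1 | move: t2]; apply: interp_ext => i;
  rewrite !tnth_map.
Qed.

Lemma hom_square_val_image H (X : set H) :
  hom_square (hom_val X) @` setT = X `*` X.
Proof.
apply/seteqP; split=> [_ [[a b] _ <-]|[a b] [Xa Xb]].
  by split; exact: set_valP.
by exists (exist _ a (mem_set Xa), exist _ b (mem_set Xb)).
Qed.

(** The square is first dismantled to [X]*[X]; the dismantling of the square of [S] is then
    transported along the inclusion. *)
Lemma dismantle_square_diagonal H (X : set H) : is_finite H ->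
  joined_by_walk (@dstep tau H) setT X ->
  let S := structure_of_sub (induced X) in
  joined_by_walk (@dstep tau (square S)) setT [set p | p.1 = p.2] ->
  exists2 Y : set (square H), joined_by_walk (@dstep tau (square H)) setT Y &
    Y `<=` [set p | p.1 = p.2].
Proof.
move=> Hfin TX S SD; exists (hom_square (hom_val X) @` [set p | p.1 = p.2]).
  apply: rt_trans (dstep_square Hfin TX) _.
  rewrite -(@hom_square_val_image H X).
  apply: (joined_map (F := fun A => _ @` A)) SD => A B AB; apply: rt_step.
  exact: dstep_embed (@hom_square_val_inj H X) (@interp_square_val H X) AB.
by move=> _ [[a b] /= -> <-].
Qed.

(** Both projections agree after the retraction [v] into the diagonal, and each is joined to its
    composite with [v]. *)
Lemma dismantle_diagonal_L_joined H (Y : set (square H)) :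
  joined_by_walk (@dstep tau (square H)) setT Y ->
  Y `<=` [set p | p.1 = p.2] ->
  joined_by_walk L_adj (pi1 H) (pi2 H).
Proof.
move=> TY YD; have [//|v Yv /L_fix_joined[idv _]] := dstep_retract (u := hom_id _) TY.
have comp (f : hom (square H) H) : joined_by_walk L_adj f (hom_comp f v).
  rewrite [X in joined_by_walk _ X](_ : f = hom_comp f (hom_id _)); last exact: hom_ext.
  apply: (joined_map (F := hom_comp f)) idv => w w' ww'.
  exact/rt_step/L_adj_compl.
apply: rt_trans (comp _) _; apply: joined_sym; first exact: L_adj_sym.
rewrite (_ : hom_comp _ _ = hom_comp (pi2 H) v); first exact: comp.
by apply: hom_ext => x; exact: (YD _ (Yv x)).
Qed.

(* A step-by-step retraction along [dstep_square] would not preserve the diagonal;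
   moving both coordinates simultaneously does. *)
Lemma diagonal_retraction H (X : set H) :
  joined_by_walk (@dstep tau H) setT X ->
  let S := structure_of_sub (induced X) in
  joined_by_walk (@dstep tau (square S)) setT [set p | p.1 = p.2] ->
  exists l (f : nat -> hom (square H) (square H)),
  [/\ f 0 = hom_id _, forall j, L_adj (f j) (f j.+1),
      forall j p, p.1 = p.2 -> (f j p).1 = (f j p).2 &
      forall p, (f l p).1 = (f l p).2].
Proof.
move=> TX S TD.
pose diag G (u : hom G (square H)) (p : G) := (u p).1 = (u p).2.
(* As an implication, preservation of the diagonal propagates along the walk from the identity. *)
pose A (u v : hom (square H) (square H)) :=
  L_adj u v /\ ((forall p, p.1 = p.2 -> diag _ u p) ->
                forall p, p.1 = p.2 -> diag _ v p).
have [//|r Xr /L_fix_joined[idr _]] := dstep_retract (u := hom_id H) TX.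
have [r' r'E] := hom_corestrict Xr.
have [//|v Dv idv] := dstep_retract (u := hom_id (square S)) TD.
pose F (w : hom (square S) (square S)) :=
  hom_comp (hom_square (hom_val X)) (hom_comp w (hom_square r')).
have AF : joined_by_walk A (hom_id _) (F v).
  apply: (@rt_trans _ _ _ (hom_square r)).
    rewrite (_ : hom_id _ = hom_square (hom_id H)); last first.
      by apply: hom_ext => -[].
    apply: joined_map idr => u w uw; apply: rt_step; split.
      exact: L_adj_square.
    by move=> _ [a b] /= ->.
  rewrite (_ : hom_square r = F (hom_id _)); last first.
    by apply: hom_ext => -[a b]; rewrite /= !r'E.
  apply: joined_map idv => u w [uw fixuw]; apply: rt_step; split.
    by apply: L_adj_compl; exact: L_adj_compr.
  (* By [val_inj] the value of [u] is on the diagonal of the square of [S], where [w] agrees with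
     [u]. *)
  move=> Du p pD; have := Du p pD; rewrite /diag /= => /val_inj uD.
  by rewrite (fixuw _ uD) uD.
have [l [f [f0 fl fA]]] := joined_seq AF; exists l, f.
have fD j : j <= l -> forall p, p.1 = p.2 -> diag _ (f j) p.
  elim: j => [_ p pD|j IH jl]; first by rewrite /diag f0.
  by case: (fA j jl) => _; apply; apply: IH; exact: ltnW.
split=> //.
- move=> j; have [/fA[]//|lj] := ltnP j l.
  by rewrite !fl ?(leqW lj)//; exact: L_adj_refl.
- move=> j; have [/fD//|/ltnW/fl ->] := leqP j l.
  by rewrite -(fl l)//; exact: fD.
- by move=> p; rewrite fl//=; congr val; exact: Dv.
Qed.

(** Following [f] up to the height [depth F l] makes the pair of [phi] and [psi] diagonal while
    changing it at finitely many points; both are thus joined to one common homomorphism. *)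
Lemma diagonal_retraction_C_connected H l (f : nat -> hom (square H) (square H)) :
  f 0 = hom_id _ -> (forall j, L_adj (f j) (f j.+1)) ->
  (forall j p, p.1 = p.2 -> (f j p).1 = (f j p).2) ->
  (forall p, (f l p).1 = (f l p).2) ->
  forall G, locally_finite G -> hom_graph_connected G H (C_adj 1).
Proof.
move=> f0 fL fD fl G Gfin phi psi Ffin.
set F := [set x | phi x <> psi x] in Ffin.
pose u : hom G (square H) := hom_pair phi psi.
have supp : finite_set [set x | depth F l x <> 0].
  apply: sub_finite_set (finite_nbhd l Gfin Ffin) => x /=; apply: contra_notP => nx.
  apply: depth_out => -[n nl xn]; apply: nx.
  by elim: l nl {fl} => // l IH; rewrite ltnS leq_eqVlt => /orP[/eqP <-|/IH]; left.
have [v vE] := glue_hom u fL (depth_lipschitz F l).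
(* On [F] the height is [l], and [f l] lands in the diagonal; off [F] the pair is diagonal already
   and every [f j] keeps it so. *)
have vD x : (v x).1 = (v x).2.
  rewrite vE; have [xF|/contrapT xF] := pselect (F x); last exact: fD.
  by rewrite depth_in.
have half (p : hom (square H) H) :
    joined_by_walk (C_adj 1) (hom_comp p u) (hom_comp p v).
  apply: (L_joined_C_joined (f := fun j => hom_comp p (f j)) (u := u)
    (h := depth F l) (l := l)) => //.
  - by move=> j; exact: L_adj_compl.
  - exact: depth_lipschitz.
  - by move=> x; exact: depth_le.
  - by move=> x; rewrite f0.
  - by move=> x; rewrite /= vE.
have -> : phi = hom_comp (pi1 H) u by exact: hom_ext.
have -> : psi = hom_comp (pi2 H) u by exact: hom_ext.
apply: rt_trans (half (pi1 H)) _; apply: joined_sym; first exact: C_adj_sym.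
rewrite (_ : hom_comp (pi1 H) v = hom_comp (pi2 H) v); first exact: half.
exact: hom_ext.
Qed.

End Squares.

(** * Finite structures and the forest of walks *)

Lemma finite_set_inj (T U : Type) (f : T -> U) :
  injective f -> finite_set [set: U] -> finite_set [set: T].
Proof.
move=> finj Ufin; have /eq_finite_set <- : (f @` [set: T] #= [set: T])%card.
  by apply: inj_card_eq => x y _ _; exact: finj.
exact: sub_finite_set Ufin.
Qed.

Lemma finite_functions (T U : Type) :
  finite_set [set: T] -> finite_set [set: U] -> finite_set [set: T -> U].
Proof.
move=> /finite_set_seq[sT sTP] /finite_set_seq[sU sUP].
pose code (f : T -> U) : {ffun 'I_(size sT) -> 'I_(size sU).+1} :=
  [ffun i => inord (index (f (tnth (in_tuple sT) i) : {classic U}) sU)].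
apply: (@finite_set_inj _ _ code); last exact: finite_finset.
move=> f g /ffunP fg; apply/funext => x.
have xs : index (x : {classic T}) sT < size sT.
  by rewrite index_mem; apply/sTP.
have := fg (Ordinal xs); rewrite !ffunE (tnth_nth (x : {classic T})) /=.
rewrite nth_index; last by apply/sTP.
move=> /(congr1 val) /=; rewrite !inordK ?ltnS ?index_size// => /(congr1 (@nth {classic U} (f x) sU)).
by rewrite !(@nth_index {classic U})//; apply/sUP.
Qed.

Section FiniteStructures.
Variable tau : signature.
Implicit Types G H : structure tau.

(* A finite structure over an infinite signature need not be locally finite; one
   violated tuple per map that is not a homomorphism has the same effect. *)
Lemma C_connected_finite H : is_finite H ->
  (forall G, countable [set: G] -> locally_finite G ->
     hom_graph_connected G H (C_adj 1)) ->
  forall G, is_finite G -> hom_graph_connected G H (C_adj 1).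
Proof.
move=> Hfin conn G Gfin.
have /choice[viol violP] : forall f : G -> H,
    exists S : set {R : tau & (arity R).-tuple G},
    [/\ finite_set S, forall p, S p -> interp G (tag p) (tagged p) &
      (forall p, S p -> interp H (tag p) (map_tuple f (tagged p))) ->
      forall R t, interp G R t -> interp H R (map_tuple f t)].
  move=> f; have [fhom|] :=
    pselect (forall R t, interp G R t -> interp H R (map_tuple f t)).
    by exists set0; split.
  move=> /existsNP[R /existsNP[t /not_implyP[Gt Hft]]].
  exists [set existT (fun R : tau => (arity R).-tuple G) R t]; split=> //.
    by move=> p /= ->.
  by move=> /(_ _ erefl).
(* [G0] keeps only the tuples selected for the finitely many maps to [H], yet has the same
   homomorphisms to [H], since [viol f] detects whether [f] is one. *)
pose G0 : structure tau := @Structure tau G (fun R => [set t | exists f : G -> H,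
  viol f (existT (fun R : tau => (arity R).-tuple G) R t)]).
have G0fin : locally_finite G0.
  move=> x; apply: (@sub_finite_set _ _ (\bigcup_(f in [set: G -> H]) viol f)).
    by move=> [R t] [[f ft] _]; exists f.
  apply: bigcup_finite; first exact: finite_functions.
  by move=> f _; case: (violP f).
have toG0 (f : hom G H) (R : tau) a : interp G0 R a -> interp H R (map_tuple f a).
  by move=> [f' af']; apply: hom_interp; case: (violP f') => _ /(_ _ af').
have toG (f : hom G0 H) (R : tau) a : interp G R a -> interp H R (map_tuple f a).
  move: R a; case: (violP f) => _ _; apply=> -[R a] fa.
  by apply: (@hom_interp _ G0 _ f); exists f.
move=> phi psi ppfin.
have -> : phi = Hom (@toG (Hom (@toG0 phi))) by exact: hom_ext.
have -> : psi = Hom (@toG (Hom (@toG0 psi))) by exact: hom_ext.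
apply: (joined_map (F := fun f : hom G0 H => Hom (@toG f))).
  by move=> u v uv; apply: rt_step; exact: uv.
by apply: conn => //; exact: finite_set_countable.
Qed.

End FiniteStructures.

Section Forest.
Variable tau : signature.
Implicit Types H : structure tau.

(** Any tuple through the end point of [w] lifts to the forest with all other entries one step
    longer; inductions from far away pass from these to [w]. *)
Lemma forest_children H (w : walk_forest H) (R : tau) (a : (arity R).-tuple H) i :
  interp H R a -> walk_end w = tnth a i ->
  exists t, [/\ interp (walk_forest H) R t, tnth t i = w &
    forall j, j != i -> walk_end (tnth t j) = tnth a j /\
                        walk_length (tnth t j) = (walk_length w).+1].
Proof.
move=> Ha wi.
have /choice[c cP] : forall j, exists w' : walk_forest H,
    (j = i -> w' = w) /\ (j != i -> is_extension w (Step a i j) w').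
  move=> j; have [->|ji] := eqVneq j i; first by exists w.
  have [|w' w'E] := walk_extend (j := j) Ha wi; first by rewrite eq_sym.
  by exists w'; split=> // E; rewrite E eqxx in ji.
have ci : c i = w by apply: (cP i).1.
exists [tuple c j | j < arity R]; split.
- exists a, i; split=> //; rewrite ?tnth_mktuple ?ci// => j ji.
  by rewrite tnth_mktuple; exact: (cP j).2.
- by rewrite tnth_mktuple.
- move=> j /(cP j).2 wj; rewrite tnth_mktuple.
  by rewrite (extension_end wj) (extension_length wj).
Qed.

Variables (H : structure tau) (X : set H).
Let S := structure_of_sub (induced X).
Variables (K : set (square S)) (r : hom H S) (rho : hom (square S) (square S)).
Let E : hom (square S) (square H) := hom_square (hom_val X).
Variables (g : nat) (gamma : hom (walk_forest (square H)) H).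

Hypothesis X_stiff :
  forall a b, X a -> X b -> dominates (induced X) b a -> b = a.
Hypothesis K_stiff :
  forall p q, K p -> K q -> p.1 <> p.2 -> dominates (induced K) q p -> q = p.
Hypothesis r_val : forall s : S, r (val s) = s.
Hypothesis rho_K : forall p, K (rho p).
Hypothesis rho_id : forall p, K p -> rho p = p.
Hypothesis gamma_far : forall w : walk_forest (square H),
  g <= walk_length w -> gamma w = (walk_end w).2.

(** Induction on the number [n] of steps missing to length [g]. A tuple through [s] is doubled and
    lifted to extensions of [w], where the claim holds; so [r (gamma w)] dominates [s], and
    stiffness gives equality. *)
Lemma forest_diagonal n (w : walk_forest (square H)) s :
  g <= walk_length w + n -> walk_end w = E (s, s) -> r (gamma w) = s.
Proof.
elim: n w s => [|n IH] w s gw ws.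
  by rewrite gamma_far ?ws ?r_val//; rewrite addn0 in gw.
apply: val_inj; apply: X_stiff; [exact: set_valP|exact: set_valP|].
move=> R i t [Ht Xt] ti.
have Ha : interp (square H) R (map_tuple (fun x => (x, x)) t).
  by split; apply: interp_ext Ht => j; rewrite !tnth_map.
have [|c [Tc ci cP]] := forest_children (i := i) (w := w) Ha.
  by rewrite ws tnth_map ti.
have cE j : tnth (tuple_subst t i (val (r (gamma w)))) j =
    val (r (gamma (tnth c j))).
  rewrite tnth_mktuple; case: eqVneq => [->|ji]; first by rewrite ci.
  have [cj lj] := cP j ji; pose s' : S := exist _ (tnth t j) (mem_set (Xt j)).
  rewrite (IH _ s')//; first by rewrite lj; lia.
  by rewrite cj tnth_map.
split; last by move=> j; rewrite cE; exact: set_valP.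
exact: (hom_interp_tnth (f := hom_comp (hom_val X) (hom_comp r gamma)) Tc).
Qed.

(** The same induction shows that [rho (p.1, r (gamma w))] dominates [p] in [K]. Stiffness of [K]
    concerns points off the diagonal; [forest_diagonal] settles the others. *)
Lemma forest_retraction n (w : walk_forest (square H)) p :
  K p -> g <= walk_length w + n -> walk_end w = E p ->
  rho (p.1, r (gamma w)) = p.
Proof.
elim: n w p => [|n IH] w p Kp gw wp.
  rewrite addn0 in gw; rewrite gamma_far// wp r_val -surjective_pairing.
  exact: rho_id.
have [pD|pND] := pselect (p.1 = p.2).
  rewrite (@forest_diagonal n.+1 w p.1)//; last by rewrite wp {2}pD -surjective_pairing.
  by rewrite {2}pD -surjective_pairing rho_id.
apply: K_stiff => // R i t [St Kt] ti.
have [|c [Tc ci cP]] := forest_children (i := i) (w := w) (hom_interp E St).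
  by rewrite wp tnth_map ti.
have cE j : tnth (tuple_subst t i (rho (p.1, r (gamma w)))) j =
    rho ((tnth t j).1, r (gamma (tnth c j))).
  rewrite tnth_mktuple; case: eqVneq => [->|ji]; first by rewrite ci ti.
  have [cj lj] := cP j ji.
  rewrite (IH _ (tnth t j))//; first by rewrite lj; lia.
  by rewrite cj tnth_map.
split; last by move=> j; rewrite cE; exact: rho_K.
pose z : (arity R).-tuple (square S) :=
  [tuple ((tnth t j).1, r (gamma (tnth c j))) | j < arity R].
apply: (hom_interp_tnth (f := rho) (t := z)); last first.
  by move=> j; rewrite cE tnth_mktuple.
split.
  by case: St => + _; apply: interp_ext => j; rewrite !tnth_map tnth_ord_tuple.
apply: (hom_interp_tnth (f := hom_comp r gamma) Tc) => j.
by rewrite !tnth_map tnth_ord_tuple.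
Qed.

End Forest.

Lemma forest_mixing_dismantles (tau : signature) (H : structure tau) g :
  is_finite H ->
  (forall (x : walk_forest (square H)) (W : set (walk_forest (square H))),
     at_least (dist_set [set x] W) g -> mixing H [set x] W) ->
  exists2 X : set H, joined_by_walk (@dstep tau H) setT X &
    let S := structure_of_sub (induced X) in
    joined_by_walk (@dstep tau (square S)) setT [set p | p.1 = p.2].
Proof.
move=> Hfin mix.
have [//|X [TX _ Xstiff]] := @dismantle_max tau H setT set0 Hfin.
exists X => //; set S := structure_of_sub (induced X) => /=.
have Sfin : finite_set [set: square S].
  rewrite -setXTT; apply: finite_setX;
    exact: (@finite_set_inj _ _ (val : S -> H) val_inj Hfin).
have [//|K [TK KD Kstiff]] :=
  @dismantle_max tau (square S) setT [set p | p.1 = p.2] Sfin.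
suff KE : K `<=` [set p | p.1 = p.2].
  by rewrite (_ : [set p | _] = K)//; apply/seteqP.
move=> p0 Kp0 /=.
have [//|u Xu /L_fix_joined[_ uX]] := dstep_retract (u := hom_id H) TX.
have [r rE] := hom_corestrict Xu.
have r_val (s : S) : r (val s) = s.
  by apply: val_inj; rewrite rE uX//; exact: set_valP.
have [//|rho rhoK /L_fix_joined[_ rho_id]] :=
  dstep_retract (u := hom_id (square S)) TK.
have x0P : is_walk (hom_square (hom_val X) p0) [::] by [].
pose x : walk_forest (square H) := Walk x0P.
pose W := [set w : walk_forest (square H) | g <= walk_length w].
have xW : at_least (dist_set [set x] W) g.
  apply/at_least_dist_set => w wx Ww; apply: leq_trans Ww _.
  have := lipschitz_walk w (@walk_length_lipschitz tau (square H)).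
  by rewrite wx.
have [gamma [gx gW]] := mix x W xW
  (hom_comp (pi1 H) (hom_walk_end _)) (hom_comp (pi2 H) (hom_walk_end _)).
have := @forest_retraction tau H X K r rho g gamma (fun a b Xa Xb => Xstiff a b Xa Xb id)
  Kstiff r_val rhoK rho_id gW g x p0 Kp0 (leqnn _) erefl.
(* At [x] the map [gamma] gives the first coordinate, so [p0] is the image under [rho] of
   [(p0.1, p0.1)], a diagonal point and hence fixed. *)
rewrite gx//= r_val rho_id; last exact: KD.
by move=> <-.
Qed.

(** * The cycle of implications between the nine conditions *)

Theorem theorem3p2 (tau : signature) (H : structure tau) (Hfin : is_finite H) :
  [<->
    (* A1s *)
    exists I : substructure H,
      dismantles_to (full H) I /\
      dismantles_to (full (square (structure_of_sub I)))
                    (diagonal_sub (structure_of_sub I));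
    (* A2s *)
    exists J : substructure (square H),
      dismantles_to (full (square H)) J /\ substructure_le J (diagonal_sub H);
    (* B1s *)
    forall G : structure tau, countable [set: G] -> locally_finite G ->
      hom_graph_connected G H (C_adj 1);
    (* B2s *)
    exists n : nat, 1 <= n /\
      forall G : structure tau, is_finite G ->
        hom_graph_connected G H (C_adj n);
    (* B3s *)
    hom_graph_connected (product one_link (square H)) H (C_adj 1);
    (* B4s *)
    forall G : structure tau, is_finite G ->
      hom_graph_connected G H L_adj;
    (* B5s *)
    joined_by_walk L_adj (pi1 H) (pi2 H);
    (* C1s *)
    exists g : nat, forall G : structure tau, countable [set: G] ->
      strongly_irreducible G H g;
    (* C2s *)
    exists g : nat,
      forall (x : walk_forest (square H)) (W : set (walk_forest (square H))),
        at_least (dist_set [set x] W) g -> mixing H [set x] W ].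
Proof.
set A1 := exists I : substructure H, _.
have sqfin : finite_set [set: square H] by rewrite -setXTT; exact: finite_setX.
have linkfin (T : finType) : is_finite (product (link tau T) (square H)).
  by rewrite /is_finite -setXTT; apply: finite_setX => //; exact: finite_finset.
have A1P : A1 <-> exists2 X : set H, joined_by_walk (@dstep tau H) setT X &
    let S := structure_of_sub (induced X) in
    joined_by_walk (@dstep tau (square S)) setT [set p | p.1 = p.2].
  split=> [[I [/dismantles_inducedP[X [-> TX]]]]|[X TX SD]].
    move=> /dismantles_inducedP[Y [/(congr1 (@suniv _ _))/= DY TY]].
    by exists X => //; rewrite DY.
  exists (induced X); split; apply/dismantles_inducedP; first by exists X.
  by exists [set p | p.1 = p.2].
have A1A2 : A1 -> exists J : substructure (square H),
    dismantles_to (full (square H)) J /\ substructure_le J (diagonal_sub H).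
  move=> /A1P[X TX SD]; have [Y TY YD] := dismantle_square_diagonal Hfin TX SD.
  exists (induced Y); split; first by apply/dismantles_inducedP; exists Y.
  by split=> // R t [Ht Yt]; split=> // i; exact: YD.
have A2B5 : (exists J : substructure (square H),
    dismantles_to (full (square H)) J /\ substructure_le J (diagonal_sub H)) ->
    joined_by_walk L_adj (pi1 H) (pi2 H).
  move=> [_ [/dismantles_inducedP[Y [-> TY]] [YD _]]].
  exact: dismantle_diagonal_L_joined TY YD.
have C2A1 : (exists g : nat,
    forall (x : walk_forest (square H)) (W : set (walk_forest (square H))),
      at_least (dist_set [set x] W) g -> mixing H [set x] W) -> A1.
  by move=> [g mix]; apply/A1P; exact: forest_mixing_dismantles Hfin mix.
(* (B5s) gives mixing on every structure, countable or not, in particular on the forest of walks. *)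
have B5A1 : joined_by_walk L_adj (pi1 H) (pi2 H) -> A1.
  move=> /L_joined_irreducible[g irr]; apply: C2A1; exists g => x W.
  exact: irr.
have A1B1 : A1 -> forall G : structure tau, countable [set: G] ->
    locally_finite G -> hom_graph_connected G H (C_adj 1).
  move=> /A1P[X TX SD]; have [l [f [f0 fL fD fl]]] := diagonal_retraction TX SD.
  by move=> G _; exact: diagonal_retraction_C_connected f0 fL fD fl G.
(* Serves (B2s) with [n.+1] points in the link, and (B3s) with [bool] and [n] equal to 1. *)
have link_B5 (T : finType) (p q : T) n : n < #|T| ->
    hom_graph_connected (product (link tau T) (square H)) H (C_adj n) ->
    joined_by_walk L_adj (pi1 H) (pi2 H).
  move=> nT conn.
  apply: (@link_slices_joined tau T n (square H) H
    (hom_comp (pi1 H) (hom_snd _ _)) (hom_comp (pi2 H) (hom_snd _ _)) p q) => //.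
    apply/negP => Tn; move: nT; rewrite ltnNge -card_le_II => /negP; apply.
    apply: card_le_trans Tn.
    rewrite (card_le_eql (card_II (n := #|T|))).
    have /card_le_eql <- : (enum_val @` [set: 'I_#|T|] #= [set: 'I_#|T|])%card.
      by apply: inj_card_eq => i j _ _; exact: enum_val_inj.
    exact: subset_card_le.
  by apply: conn; apply: sub_finite_set (linkfin T).
have B4B5 : (forall G : structure tau, is_finite G -> hom_graph_connected G H L_adj) ->
    joined_by_walk L_adj (pi1 H) (pi2 H).
  by move=> conn; apply: conn => //; exact: sub_finite_set sqfin.
tfae.
- exact: A1A2.
- by move=> /A2B5/B5A1/A1B1.
- move=> B1; exists 1; split=> //; exact: C_connected_finite.
- move=> [n [_ conn]]; apply: (C_connected_finite Hfin); last exact: (linkfin bool).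
  apply/A1B1/B5A1/(link_B5 'I_n.+1 ord0 ord0 n); first by rewrite card_ord.
  exact/conn/linkfin.
- move=> /(link_B5 bool true true 1); rewrite card_bool => /(_ isT) pp G _ phi psi _.
  exact: L_joined_all.
- exact: B4B5.
- by move=> /L_joined_irreducible[g irr]; exists g => G _; exact: irr.
(* (C1s) speaks of countable structures, but the forest may be uncountable; the detour through (B5s)
   covers it, with a new gap [g']. *)
- move=> [g irr]; have [g' irr'] := L_joined_irreducible (irreducible_L_joined Hfin irr).
  by exists g' => x W; exact: irr'.
- exact: C2A1.
Qed.
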